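(* Let $c \ge 5$ be an integer, and let $\mathcal{G}_{c\text{-deg}}$ be the family of $c$-degenerate graphs. Then $$(2+o(1)) \frac{\log(n)}{\log\left(\frac{c}{c-2}\right)} \;\le\; d(n, \mathcal{G}_{c\text{-deg}}) \;\le\; (12+o(1)) \frac{\log(n)}{\log\left(\frac{c}{c-2}\right)}$$ as $n \rightarrow \infty$, where $d(n,\mathcal{G}_{c\text{-deg}})$ is the maximum diameter of a path-pairable $c$-degenerate graph on $n$ vertices.
   Context: All graphs are finite, simple and undirected. For a positive integer $k$, a graph $G$ on at least $2k$ vertices is $k$-path-pairable if for any pair of disjoint sets of distinct vertices $\{x_1,\dots,x_k\}$ and $\{y_1,\dots,y_k\}$ of $G$ there exist $k$ pairwise edge-disjoint paths $P_1,\dots,P_k$ in $G$ such that $P_i$ is a path from $x_i$ to $y_i$ for each $1\le i\le k$. A $k$-path-pairable graph on $2k$ or $2k+1$ vertices is called path-pairable. An $n$-vertex graph $G$ is $c$-degenerate if there exists an ordering $v_1,\ldots,v_n$ of its vertices such that $|\{v_j : j>i,\ v_iv_j\in E(G)\}|\le c$ for all $i=1,\ldots,n$. For a graph $G$, $d(G)$ denotes its diameter. For a family of graphs $\mathcal{G}$, $$d(n,\mathcal{G}) = \max\{d(G) : G\in\mathcal{G} \text{ and } G \text{ is path-pairable on } n \text{ vertices}\}.$$ Here $c$ is fixed, and $o(1)$ denotes a quantity tending to $0$ as $n\to\infty$. *)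

(* Defs.v *)
From HB Require Import structures.
From mathcomp Require Import all_boot boolp.

Set Implicit Arguments.
Unset Strict Implicit.
Unset Printing Implicit Defensive.

(* Finite simple undirected graphs, represented by their edge sets: an edge is
   a set of exactly two vertices. *)
Section SimpleGraph.
Variable V : finType.

Record sgraph := SGraph {
  edges : {set {set V}};
  edges_card2 : [forall e in edges, #|e| == 2]
}.

HB.instance Definition _ := [isSub for edges].
HB.instance Definition _ := [Finite of sgraph by <:].

Implicit Types (G : sgraph) (x y : V) (p : seq V).

Definition adj G : rel V := fun x y => [set x; y] \in edges G.

(* The path x :: p has size p edges. *)
Definition is_path G x y p : bool :=
  [&& path (adj G) x p, last x p == y & uniq (x :: p)].

Definition path_edges x p : seq {set V} := pairmap (fun u v => [set u; v]) x p.

(* The pairs are (x i, y i) with i : 'I_k; the first three hypotheses say that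
   the 2k terminals are distinct. *)
Definition k_path_pairable (k : nat) G : Prop :=
  2 * k <= #|V| /\
  forall x y : 'I_k -> V,
    injective x -> injective y -> (forall i j, x i != y j) ->
    exists P : 'I_k -> seq V,
      (forall i, is_path G (x i) (y i) (P i)) /\
      (forall i j, i != j ->
         [disjoint path_edges (x i) (P i) & path_edges (x j) (P j)]).

Definition path_pairable G : Prop :=
  exists k : nat,
    [/\ 0 < k, #|V| = 2 * k \/ #|V| = 2 * k + 1 & k_path_pairable k G].

Definition degenerate (c : nat) G : Prop :=
  exists v : 'I_#|V| -> V, bijective v /\
    forall i : 'I_#|V|,
      #|[set v j | j : 'I_#|V| & (i < j) && adj G (v i) (v j)]| <= c.

(* Length of a shortest path from x to y. Paths do not repeat vertices, so
   their lengths are smaller than #|V|; the value #|V| means that x and y are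
   not connected, which does not happen in a path-pairable graph. *)
Definition gdist G x y : nat :=
  \big[minn/#|V|]_(k < #|V| | [exists p : k.-tuple V, is_path G x y p]) k.

Definition diameter G : nat := \max_(x : V) \max_(y : V) gdist G x y.

End SimpleGraph.

(* A family of graphs is a predicate on graphs over arbitrary finite vertex
   types. Up to isomorphism an n-vertex graph has vertex set 'I_n. The maximum
   is 0 if no graph qualifies; for the degenerate families with c >= 1 and
   n >= 2, the star on n vertices always does. *)
Definition max_diameter (n : nat) (F : forall V : finType, sgraph V -> Prop)
    : nat :=
  \max_(G : sgraph 'I_n | `[< F _ G /\ path_pairable G >]) diameter G.

(* Main.v *)
Require Import Defs.
From mathcomp Require Import all_boot all_order all_algebra zify ring lra.

(** Why the theorem holds.

    Upper bound. In a path-pairable graph on n vertices every set S of at most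
    n/2 vertices has at least #|S| edges leaving it, because the vertices of S
    can all be paired with vertices outside S (leq_card_cut). Let B_k be the
    ball of radius k around a vertex. The edges leaving B_(k+1) lie inside
    B_(k+2) minus B_k, and by degeneracy there are at most c times as many of
    them as vertices there. Hence, as long as #|B_(k+1)| <= n/2, two more
    steps multiply the size of a ball by at least (c+1)/c (ball_step). Two
    vertices at distance d have disjoint balls of radius just below d/2, and
    the smaller of the two grows unhindered, so d is at most
    4 ln n / ln ((c+1)/c) + 4 (diameter_le). The constant 12 and the condition
    c >= 5 come from ((c+1)/c)^3 >= c/(c-2), which is false for c = 4.

    Lower bound. The extremal graph is a network in which every vertex can
    send one token to the middle, all tokens travelling along edge-disjoint
    paths. A branch of the network is the set of numbers 0..m, cut into blocks
    of c consecutive numbers; the b-th block is completely joined to c+1 later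
    numbers, its children. A vertex outside the first block has c parents,
    receives one token from each of them, adds its own and forwards the c+1
    tokens to its c+1 children (forward). Numbers grow by a factor of about
    (c+1)/c along an edge, so going through a branch takes about
    ln m / ln ((c+1)/c) steps. A token that would be sent to a number above m
    goes to a private leaf instead, and all leaves, together with a large
    supply of further ones, are joined to three hubs. Reading edges from children to parents and from leaves to hubs
    shows that the graph is c-degenerate (toward_outdegree).

    A pair of terminals is connected by sending both of their tokens to a
    common hub. A leaf carries at most two tokens, its own and one from a
    branch, so each pair competes for leaf-hub edges with at most two others,
    and a greedy colouring of the pairs by the three hubs avoids all conflicts
    (hubs_k_path_pairable). With two branches the diameter is twice the length
    of a branch up to an additive constant (exists_long_network), and
    (c+1)/c <= c/(c-2). Since m is a constant fraction of n, all constants are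
    absorbed in terms of order 1 / ln n. *)

Set Implicit Arguments.
Unset Strict Implicit.
Unset Printing Implicit Defensive.

(** * Walks, paths and distances *)

Section Walks.
Variables (V : finType) (G : sgraph V).
Implicit Types (x y z : V) (p : seq V) (S W : {set V}).

Lemma adj_sym x y : adj G x y = adj G y x.
Proof. by rewrite /adj setUC. Qed.

Lemma edge_card2 e : e \in edges G -> #|e| = 2.
Proof. by move=> eG; apply/eqP; move/forall_inP: (edges_card2 G); apply. Qed.

Lemma path_edges_cat x p1 p2 :
  path_edges x (p1 ++ p2) = path_edges x p1 ++ path_edges (last x p1) p2.
Proof. by elim: p1 x => //= y p1 IH x; rewrite IH. Qed.

Lemma last_rev_belast x p : last (last x p) (rev (belast x p)) = x.
Proof. by case: p => //= y p; rewrite rev_cons last_rcons. Qed.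

Lemma rev_path_adj x p :
  path (adj G) (last x p) (rev (belast x p)) = path (adj G) x p.
Proof. by rewrite rev_path; apply: eq_path => y z; rewrite adj_sym. Qed.

Lemma path_edges_rev x p :
  path_edges (last x p) (rev (belast x p)) =i path_edges x p.
Proof.
elim: p x => //= y p IH x e; rewrite rev_cons -cats1 path_edges_cat mem_cat IH.
by rewrite last_rev_belast /= !inE setUC orbC.
Qed.

Lemma path_edges_shorten x p :
  {subset path_edges x (shorten x p) <= path_edges x p}.
Proof.
(* The recursion of shorten drops the vertices of p one at a time, so the
   invariant also says that dropping stops no later than at an occurrence
   of x in p. *)
suff [] : {subset path_edges x (shorten x p) <= path_edges x p} /\
  (x \in p -> {subset path_edges x (shorten x p)
                 <= path_edges (head x p) (behead p)}) by [].
elim: p x => [|y p IH] x; first by split.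
have suf : x \in p -> {subset path_edges x (shorten x p) <= path_edges y p}.
  move=> xp e eP; have [_ /(_ xp e eP)] := IH x.
  by case: p {IH eP xp} => //= z p; rewrite inE => ->; rewrite orbT.
have main : x \in y :: p ->
    {subset path_edges x (shorten x p) <= path_edges y p}.
  rewrite inE; case xp: (x \in p); first by move=> _; apply: suf.
  by rewrite orbF => /eqP<-; have [] := IH x.
split=> [e|xyp]; rewrite /= ?xyp; last exact: main.
case: ifP => [xyp|_]; first by rewrite inE => /(main xyp)->; rewrite orbT.
by rewrite /= !inE => /orP[->//|/((IH y).1 e)->]; rewrite orbT.
Qed.

Lemma is_path_shorten x p :
  path (adj G) x p -> is_path G x (last x p) (shorten x p).
Proof.
by move=> xp; rewrite /is_path; case: (shortenP xp) => q -> -> _; rewrite eqxx.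
Qed.

Lemma bigmin_le (d : nat) (I : eqType) (s : seq I) (P : pred I) F i :
  i \in s -> P i -> \big[minn/d]_(k <- s | P k) F k <= F i.
Proof.
elim: s => //= k s IH; rewrite inE big_cons => /orP[/eqP<- ->|ins Pi].
  exact: geq_minl.
case: ifP => _; last exact: IH.
exact: leq_trans (geq_minr _ _) (IH ins Pi).
Qed.

(** Shortening turns any walk into a path with no more edges. *)
Lemma gdist_le x p : path (adj G) x p -> gdist G x (last x p) <= size p.
Proof.
move=> xp; have := is_path_shorten xp.
set q := shorten x p => /and3P[xq /eqP lq uq].
have szq : size q < #|V|.
  by rewrite -[(size q).+1]/(size (x :: q)) -(card_uniqP uq) max_card.
have le_qp : size q <= size p.
  by rewrite /q; case: (shortenP xp) => r _ /andP[_ ur] sr; apply: uniq_leq_size.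
apply: leq_trans le_qp; rewrite /gdist.
apply: (@bigmin_le _ _ _ _ (fun k : 'I_#|V| => k : nat) (Ordinal szq)).
  by rewrite mem_index_enum.
by apply/existsP; exists (in_tuple q); apply/and3P; split; rewrite ?lq.
Qed.

(** The default value #|V| of the minimum defining gdist is out of reach of
    a path, which has at most #|V| vertices. *)
Lemma gdist_attained x p : path (adj G) x p ->
  exists2 q, is_path G x (last x p) q & size q = gdist G x (last x p).
Proof.
move=> xp; set y := last x p.
have : gdist G x y = #|V| \/ exists2 q, is_path G x y q & size q = gdist G x y.
  rewrite /gdist; apply: (big_ind (fun d =>
    d = #|V| \/ exists2 q, is_path G x y q & size q = d)); first by left.
    by move=> a b; case: (leqP a b).
  by move=> k /existsP[q pq]; right; exists q; rewrite ?size_tuple.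
case=> // far; have /and3P[xq /eqP lq uq] := is_path_shorten xp.
have := gdist_le xq; rewrite lq -/y far leqNgt.
by rewrite -[(size _).+1]/(size (x :: _)) -(card_uniqP uq) max_card.
Qed.

Lemma leq_diameter x y : gdist G x y <= diameter G.
Proof.
by apply: leq_trans (leq_bigmax x); apply: (leq_bigmax (F := gdist G x)).
Qed.

(** * Edge cuts of path-pairable graphs *)

Definition cut S : {set {set V}} :=
  [set e in edges G | [exists u in S, exists w in ~: S, e == [set u; w]]].

Lemma path_crosses_cut S x p :
    path (adj G) x p -> x \in S -> last x p \notin S ->
  exists2 e, e \in path_edges x p & e \in cut S.
Proof.
elim: p x => [|y p IH] x /=; first by move=> _ ->.
move=> /andP[xy yp] xS lS; case yS: (y \in S).
  by have [e ep eS] := IH _ yp yS lS; exists e; rewrite // inE ep orbT.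
exists [set x; y]; first by rewrite mem_head.
rewrite inE -[_ \in edges G]/(adj G x y) xy; apply/exists_inP; exists x => //; apply/exists_inP; exists y => //.
by rewrite inE yS.
Qed.

(** The vertices of S can all be paired with vertices outside S, and each of
    these demands needs an edge of its own across the cut. *)
Lemma leq_card_cut k S : k_path_pairable k G -> #|S| <= k -> #|S| <= #|cut S|.
Proof.
move=> [k2V pairable] Sk.
have kV : 2 * k <= #|V| := k2V.
case: (set_0Vmem S) => [->|[x0 _]]; first by rewrite cards0.
(* The first k vertices of s, which include S, are paired with the next k. *)
pose s := enum S ++ enum (~: S).
have size_s : size s = #|V| by rewrite size_cat -!cardE cardsC.
have uniq_s : uniq s.
  rewrite cat_uniq !enum_uniq andbT /=; apply/hasPn => z.
  by rewrite !mem_enum inE.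
have nth_in i : i < #|S| -> nth x0 s i \in S.
  by move=> iS; rewrite nth_cat -cardE iS -mem_enum mem_nth // -cardE.
have nth_out i : #|S| <= i < #|V| -> nth x0 s i \notin S.
  case/andP=> Si iV; rewrite nth_cat -cardE ltnNge Si /=.
  have : nth x0 (enum (~: S)) (i - #|S|) \in enum (~: S).
    by apply: mem_nth; rewrite -cardE; have := cardsC S; lia.
  by rewrite mem_enum inE.
pose x (i : 'I_k) := nth x0 s i; pose y (i : 'I_k) := nth x0 s (k + i).
have [||i j|P [Pp Pd]] := pairable x y.
- move=> i j /eqP; rewrite nth_uniq ?size_s //; first by move=> /eqP/val_inj.
    by have := ltn_ord i; lia.
  by have := ltn_ord j; lia.
- move=> i j /eqP; rewrite nth_uniq ?size_s // ?eqn_add2l.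
  - by move=> /eqP/val_inj.
  - by have := ltn_ord i; lia.
  by have := ltn_ord j; lia.
- have := ltn_ord i; have := ltn_ord j => jk ik.
  by rewrite /x /y nth_uniq ?size_s //; lia.
have crossing (i : 'I_#|S|) :
    exists2 e, e \in path_edges (x (widen_ord Sk i)) (P (widen_ord Sk i))
             & e \in cut S.
  have /and3P[xp /eqP ly _] := Pp (widen_ord Sk i).
  apply: path_crosses_cut xp _ _; first exact: (nth_in i (ltn_ord i)).
  rewrite ly nth_out //=; have iS : nat_of_ord i < #|S| := ltn_ord i.
  by apply/andP; split; [lia|apply: leq_trans kV; lia].
have [e eP eS] := fin_all_exists2 crossing.
have inj_e : injective e.
  move=> i j eij; apply/eqP/negPn/negP => ij.
  have /disjointFr/(_ (eP i)) : [disjoint path_edges (x (widen_ord Sk i))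
      (P (widen_ord Sk i)) & path_edges (x (widen_ord Sk j)) (P (widen_ord Sk j))].
    by apply: Pd; rewrite -(inj_eq val_inj).
  by rewrite eij eP.
rewrite -{1}(card_ord #|S|) -(card_imset _ inj_e); apply: subset_leq_card.
by apply/subsetP => _ /imsetP[i _ ->].
Qed.

(** * Degeneracy bounds the number of edges inside a vertex set *)

Lemma degenerate_edges_within c W :
  degenerate c G -> #|[set e in edges G | e \subset W]| <= c * #|W|.
Proof.
move=> [v [bij_v deg_v]].
(* Charge each edge to its endpoint that comes first in the ordering. *)
pose L (i : 'I_#|V|) := [set v j | j : 'I_#|V| & (i < j) && adj G (v i) (v j)].
apply: (@leq_trans #|\bigcup_(i | v i \in W) [set [set v i; u] | u in L i]|).
  apply: subset_leq_card; apply/subsetP => e; rewrite inE => /andP[eG eW].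
  have /eqP/cards2P[a [b [ab eE]]] := edge_card2 eG.
  have [v' vK v'K] := bij_v.
  have claim a' b' : a' \in W -> v' a' < v' b' -> adj G a' b' ->
      [set a'; b'] \in \bigcup_(i | v i \in W) [set [set v i; u] | u in L i].
    move=> aW lt_ab adj_ab; apply/bigcupP; exists (v' a'); rewrite v'K //.
    by apply/imsetP; exists b' => //; apply/imsetP; exists (v' b'); rewrite ?inE ?v'K ?lt_ab.
  move: eG eW; rewrite eE subUset !sub1set => eG /andP[aW bW].
  case: (ltngtP (v' a) (v' b)) => [lt_ab|lt_ba|eq_ab].
  - exact: claim.
  - by rewrite setUC; apply: claim; rewrite // adj_sym.
  by case/eqP: ab; apply: (can_inj v'K); apply: val_inj.
rewrite mulnC -sum_nat_const.
apply: leq_trans (_ : \sum_(i | v i \in W) #|[set [set v i; u] | u in L i]| <= _).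
  elim/big_rec2: _ => [|i a b _ le_ba]; first by rewrite cards0.
  by apply: leq_trans (leq_card_setU _ _) _; rewrite leq_add2l.
rewrite (reindex v (onW_bij _ bij_v)) /=.
by apply: leq_sum => i _; apply: leq_trans (leq_imset_card _ _) (deg_v i).
Qed.

(** * Growth of balls *)

Fixpoint ball x k : {set V} :=
  if k is k'.+1 then
    ball x k' :|: [set z | [exists u in ball x k', adj G u z]]
  else [set x].

Lemma ball_mono x i j : i <= j -> ball x i \subset ball x j.
Proof.
by move=> /subnKC<-; elim: (j - i) => [|k IH];
  rewrite ?addn0 // addnS (subset_trans IH) // subsetUl.
Qed.

Lemma ball_adj x k u z : u \in ball x k -> adj G u z -> z \in ball x k.+1.
Proof.
move=> uB uz; rewrite inE; apply/orP; right; rewrite inE.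
by apply/exists_inP; exists u.
Qed.

Lemma ball_walk x k z : z \in ball x k ->
  exists p, [/\ path (adj G) x p, last x p = z & size p <= k].
Proof.
elim: k z => [|k IH] z /=; first by move/set1P->; exists [::].
rewrite !inE => /orP[/IH[p [xp lp sp]]|/exists_inP[u /IH[p [xp lp sp]] uz]].
  by exists p; split=> //; apply: leqW.
by exists (rcons p z); rewrite rcons_path last_rcons size_rcons xp lp.
Qed.

(** A common vertex would join x and y by a walk of length at most i + j. *)
Lemma ball_disjoint x y i j :
  i + j < gdist G x y -> [disjoint ball x i & ball y j].
Proof.
move=> ijd; apply/pred0P => z /=; apply/negP => /andP[].
move=> /ball_walk[p [xp lp sp]] /ball_walk[q [yq lq sq]].
have pq : path (adj G) x (p ++ rev (belast y q)).
  by rewrite cat_path xp lp -lq rev_path_adj.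
have := gdist_le pq; rewrite last_cat lp -lq last_rev_belast.
by rewrite size_cat size_rev size_belast; lia.
Qed.

(** A cut edge of the ball of radius k+1 lies inside the two layers around
    its boundary. *)
Lemma ball_step c m x k :
    degenerate c G -> k_path_pairable m G -> #|ball x k.+1| <= m ->
  c.+1 * #|ball x k| <= c * #|ball x k.+2|.
Proof.
move=> deg pp small; have le_cut := leq_card_cut pp small.
pose W := ball x k.+2 :\: ball x k.
have cutW : cut (ball x k.+1) \subset [set e in edges G | e \subset W].
  apply/subsetP => e; rewrite /cut 1!inE => /andP[eG].
  case/exists_inP=> u uB /exists_inP[w wB /eqP eE].
  have wNB : w \notin ball x k.+1 by move: wB; rewrite inE.
  have uw : adj G u w by rewrite /adj -eE.
  have uW : u \in W.
    rewrite inE (subsetP (ball_mono x (leqnSn k.+1)) u uB) andbT.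
    by apply/negP => uB'; case/negP: wNB; apply: ball_adj uw.
  have wW : w \in W.
    rewrite inE (ball_adj uB uw) andbT.
    by apply/negP => wB'; case/negP: wNB; apply: (subsetP (ball_mono x (leqnSn k))).
  by rewrite inE eG eE subUset !sub1set uW.
have := leq_trans le_cut (leq_trans (subset_leq_card cutW)
                            (degenerate_edges_within W deg)).
have := cardsD (ball x k.+2) (ball x k).
rewrite (setIidPr (ball_mono x (leq_trans (leqnSn k) (leqnSn k.+1)))) -/W.
have := subset_leq_card (ball_mono x (leq_trans (leqnSn k) (leqnSn k.+1))).
have := subset_leq_card (ball_mono x (leqnSn k)).
move=> le_k1 le_k2 -> le_k; have := leq_mul (leqnn c) le_k2.
by move: le_k; rewrite mulnBr mulSn; lia.
Qed.

(** Smallness of the last ball passes to all earlier ones. *)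
Lemma ball_growth c m x j :
    degenerate c G -> k_path_pairable m G -> #|ball x j.*2| <= m ->
  c.+1 ^ j <= c ^ j * #|ball x j.*2|.
Proof.
move=> deg pp; elim: j => [|j IH] small; first by rewrite /= cards1.
have le_m i : i <= j.+1.*2 -> #|ball x i| <= m.
  by move=> /(ball_mono x)/subset_leq_card/leq_trans->.
have := ball_step deg pp (le_m j.*2.+1 (leqnSn _)); rewrite -doubleS => step.
have {}IH := IH (le_m j.*2 (leq_trans (leqnSn _) (leqnSn _))).
rewrite !expnS; apply: leq_trans (_ : c.+1 * (c ^ j * #|ball x j.*2|) <= _).
  by rewrite leq_mul2l IH orbT.
by rewrite mulnCA -mulnA [in X in _ <= X]mulnCA leq_mul2l step orbT.
Qed.

End Walks.

(** Balls of radius less than d / 2 around two vertices at distance d are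
    disjoint, so one of them contains at most half of the vertices. *)
Lemma diameter_le (V : finType) (G : sgraph V) c :
    degenerate c G -> path_pairable G ->
  exists2 j, diameter G <= 4 * j + 4 & c.+1 ^ j <= c ^ j * #|V|.
Proof.
move=> deg [k [k_gt0 cardV2 pp]].
have cardV : #|V| = 2 * k \/ #|V| = 2 * k + 1 := cardV2.
have V_gt0 : 0 < #|V| by lia.
(* The balls used below have radius 2j, and 4j < diameter G. *)
exists ((diameter G).-1 %/ 4); first by have := divn_eq (diameter G).-1 4;
  have := ltn_pmod (diameter G).-1 (isT : 0 < 4); lia.
have /card_gt0P[x0 _] := V_gt0.
have [x] := eq_bigmax (fun x : V => \max_(y : V) gdist G x y) V_gt0.
have [y ->] := eq_bigmax (gdist G x) V_gt0.
rewrite -[\max_x _]/(diameter G) => diamE.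
set j := _ %/ 4.
case: (posnP (diameter G)) => [d0|d_gt0].
  by rewrite /j d0 div0n !expn0 mul1n.
have lt_d : j.*2 + j.*2 < gdist G x y.
  by rewrite -diamE; have := leq_trunc_div (diameter G).-1 4; rewrite -/j; lia.
have := ball_disjoint lt_d => /disjoint_setI0 disj.
have : #|ball G x j.*2| + #|ball G y j.*2| <= #|V|.
  by rewrite -cardsUI disj cards0 addn0 max_card.
move=> le_V.
have grow z : #|ball G z j.*2| <= k -> c.+1 ^ j <= c ^ j * #|V|.
  move=> small; apply: leq_trans (ball_growth deg pp small) _.
  by rewrite leq_mul2l max_card orbT.
case: (leqP #|ball G x j.*2| k) => [/grow //|gtk]; apply: (grow y); lia.
Qed.

(** * Graphs given by an orientation *)

Lemma eq_set2 (T : finType) (a b u w : T) :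
  [set a; b] = [set u; w] -> a = u /\ b = w \/ a = w /\ b = u.
Proof.
move=> E.
have : a \in [set u; w] by rewrite -E set21.
have : b \in [set u; w] by rewrite -E set22.
have : u \in [set a; b] by rewrite E set21.
have : w \in [set a; b] by rewrite E set22.
rewrite !inE => /orP[]/eqP-> /orP[]/eqP-> /orP[]/eqP ? /orP[]/eqP ?; subst; tauto.
Qed.

Section Orientation.
Variables (V : finType) (R : rel V).

Definition orientation_edges : {set {set V}} :=
  [set e | [exists u, exists w, [&& u != w, R u w & e == [set u; w]]]].

Fact orientation_edges_card2 : [forall e in orientation_edges, #|e| == 2].
Proof.
apply/forall_inP => e; rewrite inE => /existsP[u /existsP[w /and3P[uw _ /eqP->]]].
by rewrite cards2 uw.
Qed.

Definition orientation_graph : sgraph V := SGraph orientation_edges_card2.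

Lemma adj_orientation u w :
  adj orientation_graph u w = (u != w) && (R u w || R w u).
Proof.
rewrite /adj /= inE; apply/existsP/andP => [[a /existsP[b]]|[uw /orP[Ruw|Rwu]]].
- move=> /and3P[ab Rab /eqP/eq_set2[][-> ->]]; rewrite ?ab ?Rab //.
  by rewrite eq_sym ab orbT.
- by exists u; apply/existsP; exists w; rewrite uw Ruw eqxx.
by exists w; apply/existsP; exists u; rewrite eq_sym uw Rwu setUC eqxx.
Qed.

(** Sorting the vertices by rank puts the later neighbours of a vertex among
    its out-neighbours. *)
Lemma orientation_degenerate c (rho : V -> nat) :
    (forall u w, R u w -> rho u < rho w) ->
    (forall u, #|[set w | R u w]| <= c) ->
  degenerate c orientation_graph.
Proof.
move=> rho_lt deg; pose s := sort (relpre rho leq) (enum V).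
have size_s : size s = #|V| by rewrite size_sort -cardE.
pose v (i : 'I_#|V|) := nth (enum_val i) s i.
have vE x0 i : v i = nth x0 s i by apply: set_nth_default; rewrite size_s.
have inj_v : injective v.
  move=> i j; rewrite (vE (enum_val i) j) => /eqP.
  by rewrite nth_uniq ?size_s ?sort_uniq ?enum_uniq // => /eqP/val_inj.
exists v; split; first by apply: inj_card_bij => //; rewrite card_ord.
move=> i; apply: leq_trans (deg (v i)); apply: subset_leq_card.
apply/subsetP => _ /imsetP[j + ->]; rewrite !inE => /andP[ij].
rewrite adj_orientation => /andP[_ /orP[//|/rho_lt]]; rewrite ltnNge => /negP[].
rewrite (vE (enum_val i) j).
apply: (@sorted_ltn_nth _ (relpre rho leq) _ (enum_val i) s _ i j) => //.
- by move=> a b d; apply: leq_trans.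
- by apply: sort_sorted => a b; apply: leq_total.
- by rewrite inE size_s.
by rewrite inE size_s.
Qed.

End Orientation.

(** * Greedy colouring with three colours *)

(** A vertex in conflict with at most two others always finds a third colour,
    so any proper precolouring f0 of a set P extends. *)
Lemma greedy_3_colouring (I : finType) (P : {set I}) (f0 : I -> 'I_3)
    (R : rel I) :
    symmetric R ->
    (forall i, exists j1 j2, forall j, j != i -> R i j -> j = j1 \/ j = j2) ->
    (forall i j, i \in P -> j \in P -> i != j -> R i j -> f0 i != f0 j) ->
  exists2 f : I -> 'I_3, {in P, f =1 f0} &
    forall i j, i != j -> R i j -> f i != f j.
Proof.
move=> symR deg2; move En: #|~: P| => n.
elim: n P f0 En => [|n IH] P f0 En f0R.
  have PT i : i \in P.
    by apply/negPn; rewrite -in_setC; rewrite (cards0_eq En) inE.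
  by exists f0 => // i j; apply: f0R.
have [i iP] : exists i, i \in ~: P by apply/card_gt0P; rewrite En.
have [j1 [j2 nbr_i]] := deg2 i.
have [a aP] : exists a, a \in ~: [set f0 j1; f0 j2].
  apply/card_gt0P; have := cardsC [set f0 j1; f0 j2].
  by rewrite card_ord cards2; case: (_ != _); lia.
have a_free j : j != i -> R i j -> f0 j != a.
  move=> ji /(nbr_i j ji) jE; apply: contraTneq aP => <-.
  by rewrite !inE; case: jE => ->; rewrite eqxx ?orbT.
have iNP : i \notin P by rewrite -in_setC.
have [|j k|f fP fR] := IH (i |: P) [eta f0 with i |-> a].
- have := cardsD1 i (~: P); rewrite iP En setCU setIC -setDE; lia.
- rewrite !inE /=; case: (eqVneq j i) => [->|ji]; case: (eqVneq k i) => [->|ki] //=.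
  + by move=> _ _ _ Rik; rewrite eq_sym; apply: a_free.
  + by move=> _ _ _; rewrite symR; apply: a_free.
  exact: f0R.
exists f => // j jP; rewrite fP ?inE ?jP ?orbT //=.
by case: eqP => // ji; rewrite ji (negPf iNP) in jP.
Qed.

(** * Path-pairability through three hubs *)

Section Hubs.
Variables (V : finType) (G : sgraph V) (h : 'I_3 -> V) (tail : V -> seq V).
Hypothesis h_inj : injective h.
Hypothesis h_adj : forall i j, i != j -> adj G (h i) (h j).

Definition is_hub v := v \in codom h.
(** The token of v follows tail v to its exit, which is adjacent to all
    hubs. *)
Definition exit v := last v (tail v).

Hypothesis tail_path : forall v, path (adj G) v (tail v).
Hypothesis tail_nohub : forall v, ~~ is_hub v -> all (predC is_hub) (tail v).
Hypothesis exit_adj : forall v j, ~~ is_hub v -> adj G (exit v) (h j).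
Hypothesis tail_disjoint : forall u v, ~~ is_hub u -> ~~ is_hub v -> u != v ->
  [disjoint path_edges u (tail u) & path_edges v (tail v)].
Hypothesis exit_two : forall u v w, ~~ is_hub u -> ~~ is_hub v -> ~~ is_hub w ->
  exit u = exit v -> exit v = exit w -> [\/ u = v, v = w | u = w].

(** A hub that is itself a terminal reaches another hub directly along the
    edge joining them. *)
Definition to_hub (k : 'I_3) v : seq V :=
  if v == h k then [::]
  else if is_hub v then [:: h k] else rcons (tail v) (h k).

Lemma hubP v : reflect (exists j, v = h j) (is_hub v).
Proof. by apply: (iffP codomP). Qed.

Lemma to_hub_path k v : path (adj G) v (to_hub k v).
Proof.
rewrite /to_hub; case: eqVneq => //= vk; case: ifP => [/hubP[j vj]|/negbT hv].
  by rewrite /= andbT vj h_adj //; apply: contra_neq vk => <-.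
by rewrite rcons_path tail_path exit_adj.
Qed.

Lemma to_hub_last k v : last v (to_hub k v) = h k.
Proof. by rewrite /to_hub; case: eqP => //= _; case: ifP; rewrite ?last_rcons. Qed.

Definition via_hub k u v := to_hub k u ++ rev (belast v (to_hub k v)).

Lemma via_hub_path k u v : path (adj G) u (via_hub k u v).
Proof.
rewrite /via_hub cat_path to_hub_path to_hub_last -(to_hub_last k v).
by rewrite rev_path_adj to_hub_path.
Qed.

Lemma via_hub_last k u v : last u (via_hub k u v) = v.
Proof.
by rewrite /via_hub last_cat to_hub_last -(to_hub_last k v) last_rev_belast.
Qed.

Lemma via_hub_edges k u v e : e \in path_edges u (via_hub k u v) ->
  e \in path_edges u (to_hub k u) \/ e \in path_edges v (to_hub k v).
Proof.
rewrite /via_hub path_edges_cat mem_cat to_hub_last -(to_hub_last k v).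
by rewrite path_edges_rev => /orP.
Qed.

Lemma exit_nohub v : ~~ is_hub v -> ~~ is_hub (exit v).
Proof.
move=> hv; have := tail_nohub hv; rewrite /exit.
by case: (tail v) => //= w p /andP[hw /allP hp]; have := mem_last w p;
  rewrite inE => /predU1P[->|/hp].
Qed.

(** Tails stay away from the hubs, which separates their edges from the edges
    at hubs. *)
Lemma tail_edge_nohub v e x :
  ~~ is_hub v -> e \in path_edges v (tail v) -> x \in e -> ~~ is_hub x.
Proof.
move=> hv; move: (tail v) (tail_nohub hv) => p0; elim: p0 v hv => //= w p IH u hu.
move=> /andP[hw hp]; rewrite inE => /orP[/eqP->|ew]; last exact: IH hw hp ew.
by rewrite !inE => /orP[]/eqP->.
Qed.

Variant to_hub_edge_spec k v (e : {set V}) : Prop :=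
| TailEdge of ~~ is_hub v & e \in path_edges v (tail v)
| ExitEdge of ~~ is_hub v & e = [set exit v; h k]
| HubEdge j of v = h j & j != k & e = [set h j; h k].

Lemma to_hub_edgeP k v e :
  e \in path_edges v (to_hub k v) -> to_hub_edge_spec k v e.
Proof.
rewrite /to_hub; case: eqVneq => //= vk; case: ifP => [/hubP[j vj]|/negbT hv].
  rewrite inE vj => /eqP->; apply: (@HubEdge _ _ _ j) => //.
  by apply: contra_neq vk => <-.
rewrite -cats1 path_edges_cat mem_cat /= inE => /orP[et|/eqP->].
  exact: TailEdge.
exact: ExitEdge.
Qed.

(** Only an edge from a common exit to a common hub, or an edge between two
    hubs used in both directions, can be shared. *)
Lemma to_hub_disjoint k l u v e :
    u != v ->
    (~~ is_hub u -> ~~ is_hub v -> exit u = exit v -> k != l) ->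
    (is_hub u -> u != h k -> v != h k) ->
  e \in path_edges u (to_hub k u) -> e \in path_edges v (to_hub l v) -> False.
Proof.
have hubh j : is_hub (h j) by apply/hubP; exists j.
move=> uv exit_uv hub_uv /to_hub_edgeP[hu eu|hu eE|i ui ik eE]
  /to_hub_edgeP[hv ev|hv e'E|j vj jl e'E].
- by have /disjointFr/(_ eu) := tail_disjoint hu hv uv; rewrite ev.
- by move: (tail_edge_nohub (x := h l) hu eu); rewrite e'E set22 hubh => /(_ isT).
- by move: (tail_edge_nohub (x := h l) hu eu); rewrite e'E set22 hubh => /(_ isT).
- by move: (tail_edge_nohub (x := h k) hv ev); rewrite eE set22 hubh => /(_ isT).
- move: e'E; rewrite eE => /eq_set2[][xE kE].
    by have := exit_uv hu hv xE; rewrite (h_inj kE) eqxx.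
  by have := exit_nohub hu; rewrite xE hubh.
- by move: e'E (exit_nohub hu); rewrite eE => /eq_set2[][-> _]; rewrite hubh.
- by move: (tail_edge_nohub (x := h k) hv ev); rewrite eE set22 hubh => /(_ isT).
- by move: e'E (exit_nohub hv); rewrite eE => /eq_set2[][E1 E2]; rewrite -?E1 -?E2 hubh.
have uk : u != h k by rewrite ui (inj_eq h_inj).
move: e'E; rewrite eE => /eq_set2[][E1 E2].
  by rewrite ui vj E1 eqxx in uv.
have := hub_uv; rewrite {1}ui hubh => /(_ isT uk).
by rewrite vj E2 eqxx.
Qed.

(** At most two tokens leave through the same exit, so at most two other pairs
    compete with a given pair for its exits, and three hubs suffice to let
    every pair meet at a hub of its own choice. *)
Lemma hubs_k_path_pairable k : 2 * k <= #|V| -> k_path_pairable k G.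
Proof.
move=> kV; split=> // x y inj_x inj_y xy.
pose t (i : 'I_k) (b : bool) := if b then x i else y i.
have t_inj i j b d : t i b = t j d -> i = j /\ b = d.
  rewrite /t; case: b d => [] [].
  - by move=> /inj_x.
  - by move=> E; have := xy i j; rewrite E eqxx.
  - by move=> E; have := xy j i; rewrite E eqxx.
  by move=> /inj_y.
have t_neq i j b d : i != j -> t i b != t j d.
  by apply: contra_neq => /t_inj[].
pose R : rel 'I_k := fun i j => [exists b, exists d,
  [&& ~~ is_hub (t i b), ~~ is_hub (t j d) & exit (t i b) == exit (t j d)]].
pose P := [set i | is_hub (x i) || is_hub (y i)].
(* A pair with a hub among its terminals must meet at one of these hubs. *)
have [f0 f0P] : exists f0 : 'I_k -> 'I_3,
    forall i, i \in P -> exists b, t i b = h (f0 i).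
  apply: (fin_all_exists (P := fun i a => i \in P -> exists b, t i b = h a)) => i.
  rewrite inE; case: (boolP (is_hub (x i))) => [/hubP[j E]|_].
    by exists j => _; exists true.
  case: (boolP (is_hub (y i))) => [/hubP[j E]|_]; last by exists ord0.
  by exists j => _; exists false.
have [||i j iP jP ij _|f fP fR] := @greedy_3_colouring _ P f0 R.
- move=> i j; apply/existsP/existsP => -[b /existsP[d /and3P[h1 h2 E]]];
    by exists d; apply/existsP; exists b; rewrite h1 h2 eq_sym.
- move=> i.
  (* At most one other terminal has the same exit as a given one. *)
  have mate b : exists j1, forall j d, j != i -> ~~ is_hub (t i b) ->
      ~~ is_hub (t j d) -> exit (t i b) = exit (t j d) -> j = j1.
    case: (boolP [exists j, exists d, [&& j != i, ~~ is_hub (t i b),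
             ~~ is_hub (t j d) & exit (t i b) == exit (t j d)]]) => [|no].
      case/existsP=> j1 /existsP[d1 /and4P[j1i hi hj1 /eqP E1]].
      exists j1 => j d ji _ hj E.
      have [] := exit_two hj1 hi hj (esym E1) E => /t_inj[] //.
      - by move=> E2; rewrite E2 eqxx in j1i.
      - by move=> E2; rewrite E2 eqxx in ji.
    exists i => j d ji hi hj E; case/negP: no.
    by apply/existsP; exists j; apply/existsP; exists d; rewrite ji hi hj E eqxx.
  have [j1 j1P] := mate true; have [j2 j2P] := mate false.
  exists j1, j2 => j ji /existsP[[] /existsP[d /and3P[hi hj /eqP E]]].
    by left; apply: j1P E.
  by right; apply: j2P E.
- have [b E1] := f0P i iP; have [d E2] := f0P j jP.
  by apply: contra_neq ij => fE; rewrite fE -E2 in E1; case/t_inj: E1.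
exists (fun i => shorten (x i) (via_hub (f i) (x i) (y i))); split=> [i|i j ij].
  by have := is_path_shorten (via_hub_path (f i) (x i) (y i)); rewrite via_hub_last.
apply/pred0P => e /=; apply/negP => /andP[].
move=> /path_edges_shorten/via_hub_edges ei /path_edges_shorten/via_hub_edges ej.
have {ei} [b ei] : exists b, e \in path_edges (t i b) (to_hub (f i) (t i b)).
  by case: ei; [exists true | exists false].
have {ej} [d ej] : exists d, e \in path_edges (t j d) (to_hub (f j) (t j d)).
  by case: ej; [exists true | exists false].
apply: (to_hub_disjoint (t_neq i j b d ij) _ _ ei ej).
  move=> hi hj E; apply: fR => //.
  by apply/existsP; exists b; apply/existsP; exists d; rewrite hi hj E eqxx.
move=> hi _; have iP : i \in P by case: b hi {ei}; rewrite inE => ->; rewrite ?orbT.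
have [b' E] := f0P i iP.
by rewrite (fP i iP) -E eq_sym; apply: t_neq.
Qed.

End Hubs.

(** * Token flow *)

Section Flow.
Variable c : nat.
Hypothesis c_gt0 : 0 < c.

(** A state (v, s) is the token in slot s of vertex v. Slots 0..c-1 hold the
    tokens of the c parents of v and slot c holds the token of v itself. The
    block of v is v %/ c; its children are c + (v %/ c) * (c + 1) + t for
    t <= c, and the token in slot s goes to the child with t = s. There it
    arrives in the slot given by the position of v in its block, so that
    forward is injective. *)
Definition forward (st : nat * nat) : nat * nat :=
  (c + st.1 %/ c * c.+1 + st.2, st.1 %% c).

Lemma forward_gt st : st.1 < (forward st).1.
Proof.
case: st => v s /=; have r_c := ltn_pmod v c_gt0.
rewrite {1}(divn_eq v c) mulnS; move: (v %/ c * c) (v %/ c) (v %% c) r_c; lia.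
Qed.

Lemma forward_slot st : (forward st).2 < c.
Proof. exact: ltn_pmod. Qed.

Lemma forward_inj st st' :
  st.2 <= c -> st'.2 <= c -> forward st = forward st' -> st = st'.
Proof.
case: st st' => [v s] [v' s'] /= sc s'c [] E Em.
have : (v %/ c * c.+1 + s) %/ c.+1 = (v' %/ c * c.+1 + s') %/ c.+1.
  by congr (_ %/ _); lia.
rewrite !divnMDl // (divn_small (_ : s < c.+1)) // (divn_small (_ : s' < c.+1)) //.
rewrite !addn0 => Ed.
by congr pair; [rewrite (divn_eq v c) (divn_eq v' c) Ed Em | rewrite Ed in E; lia].
Qed.

Lemma iter_forward_slot i st : st.2 <= c -> (iter i forward st).2 <= c.
Proof. by case: i => //= i _; apply: ltnW; apply: forward_slot. Qed.

(** Slot c is never the target of forward, so the injective map forward has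
    disjoint orbits from different starting states. *)
Lemma iter_forward_start st st' i j : st.2 = c -> st'.2 = c ->
  iter i forward st = iter j forward st' -> st = st'.
Proof.
move=> sc s'c; elim: i j => [|i IH] [|j] //= E.
- by have := forward_slot (iter j forward st'); rewrite -E sc ltnn.
- by have := forward_slot (iter i forward st); rewrite E s'c ltnn.
apply: (IH j); apply: forward_inj E; apply: iter_forward_slot; first by rewrite sc.
by rewrite s'c.
Qed.

(** A child and the slot of an incoming token determine the sender. *)
Lemma forward_parent v s w t : s <= c -> forward (v, s) = (w, t) ->
  v = (w - c) %/ c.+1 * c + t.
Proof.
move=> sc [<- <-]; rewrite -addnA addKn divnMDl // (divn_small (_ : s < c.+1)) // addn0.
exact: divn_eq.
Qed.

(** The shift 2 c^2 absorbs the rounding, so that the growth factor (c+1)/c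
    holds without error term. *)
Lemma forward_growth st : st.2 <= c ->
  c * ((forward st).1 + (c ^ 2).*2) <= c.+1 * (st.1 + (c ^ 2).*2).
Proof.
case: st => v s /= sc; have := leq_mul (leqnn c) sc.
have : c * (v %/ c * c.+1) <= c.+1 * v.
  by rewrite mulnA mulnC leq_mul2l [c * _]mulnC leq_trunc_div orbT.
move: (v %/ c * c.+1) => q.
have : (c ^ 2).*2 = c * c + c * c by rewrite -mulnn addnn.
move: (c ^ 2).*2 => K KE; rewrite !mulnDr [c.+1 * K]mulSn.
move: (c * K) (c * q) (c * s) (c.+1 * v) (c * c) KE; lia.
Qed.

(** * The network *)

Variables m N : nat.

(** Three hubs, two branches and the leaves. *)
Definition vertex : finType := ('I_3 + bool * 'I_m.+1 + 'I_N.+1)%type.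

(** Number of the private leaf of a token that leaves branch b in state st. *)
Definition code (b : bool) (st : nat * nat) : nat := (st.1 * c + st.2).*2 + b.

Lemma code_inj b b' st st' : st.2 < c -> st'.2 < c ->
  code b st = code b' st' -> b = b' /\ st = st'.
Proof.
case: st st' => [v s] [v' s'] /= sc s'c E.
have Eb : b = b'.
  have : odd (code b (v, s)) = odd (code b' (v', s')) by rewrite E.
  by rewrite /code !oddD !odd_double; case: (b); case: (b').
move: E; rewrite /code Eb => /eqP; rewrite eqn_add2r => /eqP/double_inj /= E.
have Ev : v = v'.
  have : (v * c + s) %/ c = (v' * c + s') %/ c by rewrite E.
  by rewrite !divnMDl // !divn_small // !addn0.
by split=> //; rewrite Ev in E *; congr pair; apply: addnI E.
Qed.

Definition place (b : bool) (st : nat * nat) : vertex :=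
  if st.1 <= m then inl (inr (b, inord st.1)) else inr (inord (code b st)).

Hypothesis code_le : forall b st, st.1 <= m -> st.2 <= c ->
  code b (forward st) <= N.

Lemma place_leaf_inj b b' st st' :
    st.1 <= m -> st'.1 <= m -> st.2 <= c -> st'.2 <= c ->
    m < (forward st).1 -> m < (forward st').1 ->
  place b (forward st) = place b' (forward st') -> b = b' /\ st = st'.
Proof.
move=> v_m v'_m s_c s'_c out out'.
rewrite /place !ifN -?ltnNge // => -[] /(congr1 val) /=.
rewrite !inordK ?ltnS ?code_le //.
case/code_inj; rewrite ?forward_slot // => -> /forward_inj-> //.
Qed.

(** Orientation towards the hubs and the tips of the branches: from child to
    parent, from private leaf to the sender of its token, from every leaf to
    the hubs; the order among the hubs is arbitrary. *)
Definition toward (u w : vertex) : bool :=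
  match w with
  | inl (inl j) =>
      match u with inl (inl i) => i < j | inl (inr _) => false | inr _ => true end
  | inl (inr (b, v)) => [exists s : 'I_c.+1, u == place b (forward (val v, val s))]
  | inr _ => false
  end.

Definition rank (u : vertex) : nat :=
  match u with
  | inl (inl j) => m.+2 + j
  | inl (inr (_, v)) => m.+1 - v
  | inr _ => 0
  end.

Lemma toward_rank u w : toward u w -> rank u < rank w.
Proof.
case: w => [[j|[b v]]|l] //=.
  case: u => [[i|[b v]]|l] //=; lia.
case/existsP=> s /eqP->; rewrite /place; have := ltn_ord v.
case: ifP => //= le_m v_m; last by lia.
have := forward_gt (val v, val s); rewrite inordK // => /=; lia.
Qed.

(** A branch vertex has its c parents as out-neighbours; a leaf has the three
    hubs and at most one sender. *)
Lemma toward_outdegree u : 3 < c -> #|[set w | toward u w]| <= c.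
Proof.
move=> c_gt3; pose hubs := [set (inl (inl j) : vertex) | j in [set: 'I_3]].
have hubs3 : #|hubs| <= 3.
  by apply: leq_trans (leq_imset_card _ _) _; rewrite cardsT card_ord.
case: u => [[i|[b v]]|l].
- apply: leq_trans (ltnW c_gt3); apply: leq_trans hubs3.
  apply: subset_leq_card; apply/subsetP => w; rewrite inE.
  case: w => [[j|[b v]]|l] //= H; first by apply/imsetP; exists j.
  by case/existsP: H => s; rewrite /place; case: ifP.
- pose parent (t : 'I_c) : vertex :=
    inl (inr (b, inord ((v - c) %/ c.+1 * c + t))).
  rewrite -[X in _ <= X]card_ord -cardsT; apply: leq_trans (leq_imset_card parent _).
  apply: subset_leq_card; apply/subsetP => w; rewrite inE.
  case: w => [[j|[b' v']]|l] //= /existsP[s /eqP].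
  rewrite /place; case: ifP => // le_m [bE vE].
  apply/imsetP; exists (Ordinal (forward_slot (val v', val s))) => //.
  rewrite /parent bE; congr (inl (inr (_, _))); apply: val_inj.
  have v'E := forward_parent (ltn_ord s) (erefl (forward (val v', val s))).
  by rewrite vE /= inordK // inordK -?v'E // ltn_ord.
rewrite -(cardsID hubs [set w | toward (inr l) w]); apply: leq_trans c_gt3.
apply: (leq_add (n1 := 3) (n2 := 1)).
  by apply: leq_trans hubs3; rewrite subset_leq_card // subsetIr.
apply/card_le1_eqP => w w'; rewrite !inE => /andP[wh lw] /andP[w'h lw'].
have branch x : x \notin hubs -> toward (inr l) x -> exists b v,
    x = inl (inr (b, v)) /\ exists2 s, s <= c &
      inr l = place b (forward (val v, s)) /\ m < (forward (val v, s)).1.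
  case: x => [[j|[b v]]|l'] //=; first by case/imsetP; exists j.
  move=> _ /existsP[s /eqP E]; exists b, v; split=> //.
  exists (val s); first by rewrite -ltnS ltn_ord.
  by split=> //; move: E; rewrite /place; case: leqP.
have [b [v [-> [s sc [E out]]]]] := branch w wh lw.
have [b' [v' [-> [s' s'c [E' out']]]]] := branch w' w'h lw'.
have v_m : val v <= m := ltn_ord v; have v'_m : val v' <= m := ltn_ord v'.
rewrite E in E'.
have [-> [vv' _]] := @place_leaf_inj b b' (val v, s) (val v', s')
                       v_m v'_m sc s'c out out' E'.
by congr (inl (inr (_, _))); apply: val_inj; rewrite /= vv'.
Qed.

Definition network : sgraph vertex := orientation_graph toward.

Lemma adj_network u w : adj network u w = toward u w || toward w u.
Proof.
rewrite adj_orientation andb_idl // => /orP[]/toward_rank.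
  by apply: contraTneq => ->; rewrite ltnn.
by apply: contraTneq => ->; rewrite ltnn.
Qed.

Lemma place_branch_inj b b' st st' :
  st.1 <= m -> place b st = place b' st' -> b = b' /\ st.1 = st'.1.
Proof.
rewrite /place => st_m; rewrite st_m; case: leqP => // st'_m [-> /(congr1 val)].
by rewrite /= !inordK.
Qed.

Lemma adj_forward b st : st.1 <= m -> st.2 <= c ->
  adj network (place b st) (place b (forward st)).
Proof.
case: st => v s /= v_m s_c; rewrite adj_network; apply/orP; right.
rewrite {2}/place v_m /=; apply/existsP; exists (inord s).
by rewrite !inordK.
Qed.

(** Tokens only move to larger numbers, so an edge of a branch tells which of
    its ends is the sender, and hence the state. *)
Lemma forward_edge_inj b b' st st' :
    st.1 <= m -> st'.1 <= m -> st.2 <= c -> st'.2 <= c ->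
  [set place b st; place b (forward st)]
    = [set place b' st'; place b' (forward st')] -> b = b' /\ st = st'.
Proof.
move=> v_m v'_m s_c s'_c /eq_set2[][E1 E2]; last first.
  have [_ lt1] := place_branch_inj v_m E1.
  have [_ lt2] := place_branch_inj v'_m (esym E2).
  by have := forward_gt st; have := forward_gt st'; lia.
have [-> Ev] := place_branch_inj v_m E1; split=> //.
case: (leqP (forward st).1 m) => [in_m|out].
  have [_ En] := place_branch_inj in_m E2.
  by apply: forward_inj => //; move: En; rewrite /forward Ev /= => ->.
have out' : m < (forward st').1.
  rewrite ltnNge; apply/negP => in_m.
  by have [_ En] := place_branch_inj in_m (esym E2); rewrite En leqNgt out in in_m.
by have [] := place_leaf_inj v_m v'_m s_c s'_c out out' E2.
Qed.

(** The trajectory of a token until it leaves the branch; k is fuel, and m + 1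
    steps always suffice because the number of the vertex increases. *)
Fixpoint route (b : bool) (k : nat) (st : nat * nat) : seq vertex :=
  if k is k'.+1 then
    if st.1 <= m then place b (forward st) :: route b k' (forward st) else [::]
  else [::].

Lemma route_path b k st :
  st.2 <= c -> path (adj network) (place b st) (route b k st).
Proof.
elim: k st => //= k IH st s_c; case: ifP => //= v_m.
by rewrite adj_forward // IH // ltnW // forward_slot.
Qed.

Lemma route_last b k st : st.1 <= m -> m - st.1 < k ->
  exists i, let st' := iter i forward st in
    [/\ st'.1 <= m, m < (forward st').1
       & last (place b st) (route b k st) = place b (forward st')].
Proof.
elim: k st => //= k IH st v_m lt_k; rewrite v_m /=.
case: (leqP (forward st).1 m) => [in_m|out].
  have [|i] := IH _ in_m; first by have := forward_gt st; lia.
  by rewrite -iterSr => iP; exists i.+1.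
exists 0; split=> //=; case: k {IH lt_k} => //= k.
by rewrite leqNgt out.
Qed.

Lemma route_edges b k st e : e \in path_edges (place b st) (route b k st) ->
  exists i, let st' := iter i forward st in
    st'.1 <= m /\ e = [set place b st'; place b (forward st')].
Proof.
elim: k st => //= k IH st; case: ifP => //= v_m; rewrite inE.
move=> /orP[/eqP->|/IH[i]]; first by exists 0.
by rewrite -iterSr => iP; exists i.+1.
Qed.

Definition hub (j : 'I_3) : vertex := inl (inl j).

Lemma place_nohub b st : ~~ is_hub hub (place b st).
Proof. by apply/hubP => -[j]; rewrite /place; case: ifP. Qed.

Lemma route_nohub b k st : all (predC (is_hub hub)) (route b k st).
Proof. by elim: k st => //= k IH st; case: ifP => //= _; rewrite place_nohub IH. Qed.

Arguments route : simpl never.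

Definition tail (u : vertex) : seq vertex :=
  if u is inl (inr (b, v)) then route b m.+1 (val v, c) else [::].

Lemma branch_place b v : inl (inr (b, v)) = place b (val v, c).
Proof. by rewrite /place /= -ltnS ltn_ord inord_val. Qed.

Lemma branch_edges b v (u := inl (inr (b, v)) : vertex) :
  path_edges u (tail u) =
  path_edges (place b (val v, c)) (route b m.+1 (val v, c)).
Proof. by rewrite {1}/u branch_place. Qed.

Lemma exit_branch b v : exists i, let st := iter i forward (val v, c) in
  [/\ st.1 <= m, m < (forward st).1
     & exit tail (inl (inr (b, v))) = place b (forward st)].
Proof.
rewrite /exit /= branch_place; apply: route_last; rewrite /=; first by rewrite -ltnS.
by rewrite ltnS leq_subr.
Qed.

(** Different branch vertices leave through different leaves, as leaves are
    private to states and the orbits of different starting states are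
    disjoint. *)
Lemma exit_branch_inj b b' v v' :
  exit tail (inl (inr (b, v))) = exit tail (inl (inr (b', v'))) ->
  (b, v) = (b', v').
Proof.
have [i [v_m out ->]] := exit_branch b v.
have [i' [v'_m out' ->]] := exit_branch b' v'.
case/place_leaf_inj; rewrite ?iter_forward_slot // => ->.
by move/(@iter_forward_start (val v, c) (val v', c) _ _ erefl erefl) => [/val_inj->].
Qed.

(** Edge-disjointness of the tails is the disjointness of orbits of forward.
    Among three vertices with the same exit two would be leaves or two would be
    branch vertices, and in both cases these two coincide. *)
Lemma network_k_path_pairable k :
  2 * k <= #|{: vertex}| -> k_path_pairable k network.
Proof.
apply: (hubs_k_path_pairable (h := hub) (tail := tail)).
- by move=> i j [].
- move=> i j ij; rewrite adj_network /=.
  by move: ij; rewrite neq_ltn.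
- by case=> [[j|[b v]]|l] //=; rewrite branch_place route_path.
- by case=> [[j|[b v]]|l] //= _; apply: route_nohub.
- move=> u j hu; rewrite adj_network; apply/orP; left.
  case: u hu => [[i|[b v]]|l] //=; first by case/hubP; exists i.
  move=> _; have [i [_ out ->]] := exit_branch b v.
  by rewrite /place leqNgt out.
- move=> u v hu hv uv; apply/pred0P => e /=; apply/negP => /andP[].
  case: u hu uv => [[i|[b x]]|l] // _; case: v hv => [[i'|[b' x']]|l'] // _ uv.
  rewrite !branch_edges => /route_edges[i [v_m ->]] /route_edges[i' [v'_m]].
  case/forward_edge_inj; rewrite ?iter_forward_slot // => bb.
  move/(@iter_forward_start (val x, c) (val x', c) _ _ erefl erefl) => [xx].
  by case/negP: uv; rewrite bb (val_inj xx).
move=> u v w hu hv hw.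
case: u hu => [[i|[b x]]|l] hu; first by case/hubP: hu; exists i.
  case: v hv => [[i'|[b' x']]|l'] hv; first by case/hubP: hv; exists i'.
    by move=> /exit_branch_inj[-> ->] _; constructor 1.
  case: w hw => [[i''|[b'' x'']]|l''] hw; first by case/hubP: hw; exists i''.
    by move=> E1 /(etrans E1)/exit_branch_inj[-> ->]; constructor 3.
  by move=> _ [->]; constructor 2.
case: v hv => [[i'|[b' x']]|l'] hv; first by case/hubP: hv; exists i'.
  case: w hw => [[i''|[b'' x'']]|l''] hw; first by case/hubP: hw; exists i''.
    by move=> _ /exit_branch_inj[-> ->]; constructor 2.
  by move=> E1 /(etrans E1)[->]; constructor 3.
by move=> [->] _; constructor 1.
Qed.

End Flow.

(** * Relabelling *)

Section Relabel.
Variables (V W : finType) (f : V -> W) (g : W -> V) (R : rel V).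
Hypotheses (fK : cancel f g) (gK : cancel g f).

Definition relabelled : sgraph W := orientation_graph (relpre g R).

Lemma adj_relabelled x y :
  adj relabelled x y = adj (orientation_graph R) (g x) (g y).
Proof. by rewrite !adj_orientation (can_eq gK). Qed.

Lemma path_edges_map x p :
  path_edges (f x) (map f p) = [seq f @: e | e : {set V} <- path_edges x p].
Proof. by elim: p x => //= y p IH x; rewrite IH imsetU1 imset_set1. Qed.

Lemma relabelled_k_path_pairable k :
  k_path_pairable k (orientation_graph R) -> k_path_pairable k relabelled.
Proof.
move=> [kV pp]; split.
  by apply: leq_trans kV _; apply: (leq_card f); apply: can_inj fK.
move=> x y inj_x inj_y xy.
have inj_g := can_inj gK.
have [i j|P [Pp Pd]] := pp (g \o x) (g \o y) (inj_comp inj_g inj_x) (inj_comp inj_g inj_y).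
  by rewrite /= (inj_eq inj_g).
exists (fun i => map f (P i)); split=> [i|i j ij].
  have /and3P[xp /eqP lp up] := Pp i.
  rewrite -[x i]gK -[y i]gK; apply/and3P; split; last first.
  - by rewrite -map_cons map_inj_uniq //; apply: can_inj fK.
  - by rewrite last_map lp.
  rewrite path_map; apply: sub_path xp => a b /=.
  by rewrite adj_relabelled !fK.
apply/pred0P => e /=; apply/negP; rewrite -[x i]gK -[x j]gK !path_edges_map.
case/andP=> /mapP[e1 e1P ->] /mapP[e2 e2P /(imset_inj (can_inj fK)) E].
by have /disjointFr/(_ e1P) := Pd i j ij; rewrite E e2P.
Qed.

End Relabel.

(** * Weights and distances *)

Import Order.TTheory GRing.Theory Num.Theory.

Section Potential.
Local Open Scope ring_scope.
Variables (F : realFieldType) (V : finType) (G : sgraph V).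
Variables (w : V -> F) (r : F).
Hypothesis r_ge0 : 0 <= r.
Hypothesis w_adj : forall u v, adj G u v -> w v <= r * w u.

(** A weight that grows by a factor of at most r along edges bounds distances
    from below. *)
Lemma potential_path x p : path (adj G) x p -> w (last x p) <= r ^+ size p * w x.
Proof.
elim: p x => [|y p IH] x /=; first by rewrite expr0 mul1r.
move=> /andP[xy /IH/le_trans->] //.
by rewrite exprSr -mulrA ler_wpM2l ?exprn_ge0 ?w_adj.
Qed.

Lemma potential_gdist x p :
  path (adj G) x p -> w (last x p) <= r ^+ gdist G x (last x p) * w x.
Proof.
move=> /gdist_attained[q /and3P[xq /eqP lq _] <-].
by rewrite -{1}lq; apply: potential_path.
Qed.

End Potential.

Section NetworkDistance.
Local Open Scope ring_scope.
Variables (F : realFieldType) (c m N : nat).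
Hypothesis c_gt0 : (0 < c)%N.

Let K : F := (c ^ 2).*2%:R.
Let M : F := m.+1%:R + K.
Let r : F := c.+1%:R / c%:R.

(** The weight is 1 at the middle of the network, about v / m on the first
    branch and about m / v on the second, so it increases by a factor of order
    m^2 from tip to tip. *)
Definition potential (u : vertex m N) : F :=
  match u with
  | inl (inr (b, v)) => if b then M / (v%:R + K) else (v%:R + K) / M
  | _ => 1
  end.

Let c_gt0F : 0 < c%:R :> F. Proof. by rewrite ltr0n. Qed.
Let K_gt0 : 0 < K. Proof. by rewrite ltr0n double_gt0 expn_gt0 c_gt0. Qed.
Let r_ge1 : 1 <= r. Proof. by rewrite ler_pdivlMr // mul1r ler_nat. Qed.

Lemma ratio_bounds (b : bool) (x y : F) : 0 < x -> x <= y -> y <= r * x ->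
  let p z := if b then M / z else z / M in
  p x <= r * p y /\ p y <= r * p x.
Proof.
move=> x0 xy yx /=; have y0 : 0 < y := lt_le_trans x0 xy.
have M0 : 0 < M by rewrite addr_gt0 // ltr0n.
have r0 : 0 <= r := le_trans ler01 r_ge1.
have xry : x <= r * y by apply: le_trans xy _; rewrite ler_peMl // ltW.
case: b; split.
- by rewrite mulrCA ler_pM2l // ler_pdivlMr // mulrC ler_pdivrMr.
- by rewrite mulrCA ler_pM2l // ler_pdivlMr // mulrC ler_pdivrMr.
- by rewrite mulrA ler_pM2r ?invr_gt0.
by rewrite mulrA ler_pM2r ?invr_gt0.
Qed.

(** A leaf has the weight that number m + 1 would have, and a token that
    leaves the branch was heading for a number of at least m + 1; so an edge
    to a leaf is covered by the same estimate as an edge inside a branch. *)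
Lemma potential_toward u v : toward c u v ->
  potential u <= r * potential v /\ potential v <= r * potential u.
Proof.
case: v => [[j|[b v]]|l] //=.
  by case: u => [[i|[b v]]|l] //=; rewrite mulr1.
case/existsP=> s /eqP->.
set st := (\val v, \val s); set x := v%:R + K.
have x_gt0 : 0 < x by rewrite ltr_wpDl.
have grow : (forward c st).1%:R + K <= r * x.
  have := @forward_growth c c_gt0 st (ltn_ord s).
  rewrite -(ler_nat F) !natrM !natrD -/K /r mulrAC => le.
  by rewrite ler_pdivlMr // mulrC.
have lt_f : (val v < (forward c st).1)%N := forward_gt c_gt0 st.
rewrite /place; case: ifP => le_m /=.
  rewrite inordK //.
  have [] // := @ratio_bounds b x ((forward c st).1%:R + K) x_gt0.
  by rewrite lerD2r ler_nat ltnW.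
have [] := @ratio_bounds b x M x_gt0.
- by rewrite lerD2r ler_nat ltnW // ltn_ord.
- apply: le_trans grow; rewrite lerD2r ler_nat ltnNge le_m //.
have -> : (if b then M / M else M / M) = 1.
  by case: b; rewrite divff // gt_eqF // addr_gt0 // ltr0n.
by [].
Qed.

End NetworkDistance.

(** * The network on n vertices *)

Section LongNetwork.
Variables (c n : nat).
Hypotheses (c_gt3 : 3 < c) (n_big : (2 * c + 5) * (4 * c ^ 2 + 3) <= n).

Lemma k_path_pairable_connected (V : finType) (G : sgraph V) (x y : V) :
    k_path_pairable 1 G -> x != y ->
  exists p, path (adj G) x p /\ last x p = y.
Proof.
move=> [_ pp] xy; have inj1 (z : V) : injective (fun _ : 'I_1 => z).
  by move=> i j _; rewrite !ord1.
have [//|P [Pp _]] := pp _ _ (inj1 x) (inj1 y).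
by have /and3P[xp /eqP lp _] := Pp ord0; exists (P ord0).
Qed.

(* Besides the 2 (m + 1) branch vertices and the hubs, about 2 (c + 1) m leaf
   numbers are needed for the codes; 2 c + 5 times m + 1 leaves room for the
   lower-order terms once m is at least 4 c^2 + 2. *)
Let m := (n %/ (2 * c + 5)).-1.
Let N := n - m.*2 - 6.

Let m_large : 4 * c ^ 2 + 2 <= m.
Proof.
have : 4 * c ^ 2 + 3 <= n %/ (2 * c + 5) by rewrite leq_divRL ?addn_gt0 ?orbT // mulnC.
rewrite /m; lia.
Qed.

Let m_le : (2 * c + 5) * m.+1 <= n.
Proof.
rewrite /m prednK; first by rewrite mulnC leq_trunc_div.
by move: m_large; rewrite /m; lia.
Qed.

Let m_ge : n < (2 * c + 5) * m.+2.
Proof.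
rewrite /m prednK; last by move: m_large; rewrite /m; lia.
by rewrite mulnC ltn_ceil // addn_gt0 orbT.
Qed.

Lemma card_network_vertex : #|{: vertex m N}| = n.
Proof.
rewrite !card_sum card_prod card_bool !card_ord /N.
have : 4 * m.+1 <= (2 * c + 5) * m.+1 by rewrite leq_mul2r; lia.
by move: m_le m_large; lia.
Qed.

Lemma network_code_le b st :
  st.1 <= m -> st.2 <= c -> code c b (forward c st) <= N.
Proof.
case: st => v s /= v_m s_c; rewrite /code /=.
have c_gt0 : 0 < c by apply: ltn_trans c_gt3.
have r_c := ltn_pmod v c_gt0.
have le_s : s * c <= c * c by rewrite leq_mul2r s_c orbT.
have le_q : v %/ c * c.+1 * c <= m * c + m.
  rewrite mulnAC -mulnSr leq_mul2r; apply/orP; right.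
  exact: leq_trans (leq_trunc_div v c) v_m.
have := m_large; rewrite -mulnn => large.
have := m_le; rewrite mulnS mulnDl -mulnA [c * m]mulnC => le_n.
rewrite !mulnDl /N; move: (v %/ c * c.+1 * c) (s * c) (v %% c) le_q le_s r_c.
by move: (c * c) (m * c) large le_n; case: b; lia.
Qed.

Let f (x : vertex m N) : 'I_n := cast_ord card_network_vertex (enum_rank x).
Let g (i : 'I_n) : vertex m N := enum_val (cast_ord (esym card_network_vertex) i).

Let fK : cancel f g.
Proof. by move=> x; rewrite /f /g cast_ordK enum_rankK. Qed.

Let gK : cancel g f.
Proof. by move=> i; rewrite /f /g enum_valK cast_ordKV. Qed.

(** Vertex 0 of either branch is its tip. The weight argument between the two
    tips bounds the distance D by ((c+1)/c)^D >= ((m + 1 + 2 c^2) / (2 c^2))^2,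
    and m + 2 exceeds n / (2 c + 5). *)
Lemma exists_long_network (F : realFieldType) :
  exists G : sgraph 'I_n,
    [/\ degenerate c G, path_pairable G &
        (n%:R / ((2 * c + 5) * (c ^ 2).*2)%:R) ^+ 2
          <= (c.+1%:R / c%:R) ^+ diameter G :> F]%R.
Proof.
have c_gt0 : 0 < c by apply: ltn_trans c_gt3.
have n_ge2 : 2 <= n by move: m_le m_large; nia.
pose G := relabelled g (@toward c m N).
have pp k : 2 * k <= n -> k_path_pairable k G.
  move=> kn; apply: (relabelled_k_path_pairable fK gK).
  by apply: (network_k_path_pairable c_gt0 network_code_le); rewrite card_network_vertex.
exists G; split.
- apply: (@orientation_degenerate _ _ c (@rank m N \o g)).
    by move=> u w /(toward_rank c_gt0).
  move=> u; apply: leq_trans (toward_outdegree c_gt0 network_code_le (g u) c_gt3).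
  rewrite -[X in _ <= X](card_imset _ (can_inj fK)); apply: subset_leq_card.
  apply/subsetP => w; rewrite inE /= => Ruw.
  by rewrite -(gK w); apply: imset_f; rewrite inE.
- exists (n %/ 2); rewrite card_ord; split; first by rewrite divn_gt0.
    by have := divn_eq n 2; have := ltn_pmod n (isT : 0 < 2); lia.
  by apply: pp; rewrite mulnC leq_trunc_div.
pose tip b : vertex m N := inl (inr (b, ord0)).
have [|p [p_path p_last]] := @k_path_pairable_connected _ G (f (tip false)) (f (tip true)) (pp 1 n_ge2).
  by rewrite (can_eq fK).
have r_ge0 : (0 <= c.+1%:R / c%:R :> F)%R by rewrite divr_ge0 ?ler0n.
have w_adj u v : adj G u v ->
    (@potential F c m N (g v) <= c.+1%:R / c%:R * @potential F c m N (g u))%R.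
  rewrite (adj_relabelled _ gK) adj_orientation => /andP[_ /orP[]] /(potential_toward F c_gt0).
    by case.
  by case.
have := potential_gdist r_ge0 w_adj p_path; rewrite p_last !fK /=.
have r_ge1 : (1 <= c.+1%:R / c%:R :> F)%R.
  by rewrite ler_pdivlMr ?ltr0n // mul1r ler_nat.
have K_ge1 : (1 <= (c ^ 2).*2%:R :> F)%R by rewrite ler1n double_gt0 expn_gt0 c_gt0.
set K : F := ((c ^ 2).*2%:R)%R in K_ge1 *; set M : F := (m.+1%:R + K)%R.
have K_gt0 : (0 < K)%R := lt_le_trans ltr01 K_ge1.
have M_gt0 : (0 < M)%R by rewrite addr_gt0 // ltr0n.
rewrite add0r -ler_pdivrMr ?divr_gt0 // invf_div -expr2 => le_gdist.
have le_M : (n%:R / (2 * c + 5)%:R <= M)%R.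
  rewrite ler_pdivrMr ?ltr0n ?addn_gt0 ?orbT //.
  apply: (@le_trans _ _ (m.+2%:R * (2 * c + 5)%:R)%R).
    by rewrite -natrM ler_nat mulnC ltnW.
  by rewrite ler_wpM2r ?ler0n // -[m.+2]addn1 natrD lerD2l.
apply: le_trans (le_trans le_gdist _); last exact: ler_weXn2l (leq_diameter _ _ _).
apply: lerXn2r; rewrite ?nnegrE ?divr_ge0 ?ler0n ?(ltW M_gt0) //.
by rewrite natrM invfM mulrA ler_pM2r ?invr_gt0.
Qed.

End LongNetwork.

(** * Asymptotics *)

From mathcomp Require Import all_classical all_reals all_analysis.
Import Order.TTheory GRing.Theory Num.Theory.
Import numFieldNormedType.Exports.
Local Open Scope classical_set_scope.
Local Open Scope ring_scope.

Lemma cvg_div_ln (R : realType) (a : R) : a / ln n%:R @[n --> \oo] --> (0 : R).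
Proof.
rewrite -[X in _ --> X](mulr0 a); apply: cvgMr.
apply/gtr0_cvgV0; first by near=> n; rewrite ln_gt0 // ltr1n; near: n; exact: nbhs_infty_gt.
apply/cvgryPge => A; near=> n.
rewrite -[A]expRK ler_ln ?posrE ?expR_gt0 //; last by rewrite ltr0n; near: n; exact: nbhs_infty_gt.
by near: n; apply: nbhs_infty_ger.
Unshelve. all: by end_near. Qed.

Lemma ratio_le (R : realType) (c : nat) : (5 <= c)%N ->
  c.+1%:R / c%:R <= c%:R / (c%:R - 2) :> R.
Proof.
move=> hc; have c5 : 5 <= c%:R :> R by rewrite (ler_nat _ 5).
rewrite -[c.+1%:R]natr1; move: (c%:R : R) c5 => x x5.
rewrite ler_pdivrMr; last lra.
rewrite mulrAC ler_pdivlMr; last lra.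
by rewrite -subr_ge0 (_ : _ - _ = x + 2); [lra | ring].
Qed.

(** Clearing denominators leaves c^3 >= 3 c^2 + 5 c + 2. *)
Lemma cube_ratio_ge (R : realType) (c : nat) : (5 <= c)%N ->
  c%:R / (c%:R - 2) <= (c.+1%:R / c%:R) ^+ 3 :> R.
Proof.
move=> hc; have c5 : 5 <= c%:R :> R by rewrite (ler_nat _ 5).
rewrite -[c.+1%:R]natr1; move: (c%:R : R) c5 => x x5.
rewrite expr_div_n ler_pdivrMr; last lra.
rewrite mulrAC ler_pdivlMr; last by rewrite exprn_gt0 //; lra.
(* The difference, expanded at 5, has positive coefficients. *)
rewrite -subr_ge0 (_ : _ - _ =
  (x - 5) ^+ 3 + 12 * (x - 5) ^+ 2 + 40 * (x - 5) + 23); last by ring.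
by rewrite !addr_ge0 ?mulr_ge0 ?exprn_ge0 ?subr_ge0.
Qed.

Lemma max_diameter_le (R : realType) (c n : nat) : (5 <= c)%N -> (1 < n)%N ->
  (max_diameter n (fun V => @degenerate V c))%:R
    <= 12 * (ln n%:R / ln (c%:R / (c%:R - 2))) + 4 :> R.
Proof.
move=> hc n1; set mu := c%:R / (c%:R - 2) : R.
have c5 : 5 <= c%:R :> R by rewrite (ler_nat _ 5).
have mu1 : 1 < mu by rewrite ltr_pdivlMr; lra.
have lnmu : 0 < ln mu by rewrite ln_gt0.
have lnn : 0 < ln n%:R :> R by rewrite ln_gt0 // ltr1n.
rewrite /max_diameter; apply: (big_ind (fun d : nat => d%:R <= _)).
- by rewrite addr_ge0 // mulr_ge0 // divr_ge0 // ltW.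
- by move=> a b; case: (leqP a b).
move=> G /asboolP[deg pp]; have [j le_d le_j] := diameter_le deg pp.
rewrite card_ord in le_j.
have lam : (c.+1%:R / c%:R) ^+ j <= n%:R :> R.
  rewrite expr_div_n ler_pdivrMr; last by rewrite exprn_gt0 //; lra.
  by rewrite -!natrX -natrM ler_nat mulnC.
have lam_gt0 : 0 < c.+1%:R / c%:R :> R by rewrite divr_gt0 ?ltr0n; lia.
have le_ln : ln (c.+1%:R / c%:R) *+ j <= ln n%:R :> R.
  rewrite -lnXn // ler_ln // posrE ?exprn_gt0 // ltr0n; lia.
have le_mu : ln mu <= ln (c.+1%:R / c%:R) *+ 3.
  rewrite -lnXn // ler_ln ?posrE ?exprn_gt0 //; first exact: cube_ratio_ge.
  by lra.
have le_j3 : j%:R <= 3 * (ln n%:R / ln mu) :> R.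
  rewrite mulrA ler_pdivlMr //; move: le_ln (ler_wpM2l (ler0n R j) le_mu).
  by rewrite -[_ *+ j]mulr_natl -[_ *+ 3]mulr_natl; lra.
have : (diameter G)%:R <= (4 * j + 4)%N%:R :> R by rewrite ler_nat.
by rewrite natrD natrM; lra.
Qed.

Lemma max_diameter_ge (R : realType) (c : nat) : (5 <= c)%N ->
  exists A : R, \forall n \near \oo,
  2 * (ln n%:R / ln (c%:R / (c%:R - 2))) - A / ln (c%:R / (c%:R - 2)) <=
  (max_diameter n (fun V => @degenerate V c))%:R.
Proof.
move=> hc; set mu := c%:R / (c%:R - 2) : R.
have c5 : 5 <= c%:R :> R by rewrite (ler_nat _ 5).
have mu1 : 1 < mu by rewrite ltr_pdivlMr; lra.
have lnmu : 0 < ln mu by rewrite ln_gt0.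
set C := ((2 * c + 5) * (c ^ 2).*2)%N.
have C_gt0 : 0 < C%:R :> R.
  by rewrite ltr0n muln_gt0 double_gt0 expn_gt0 addn_gt0 orbT /=; lia.
exists (2 * ln C%:R); near=> n.
have n_big : ((2 * c + 5) * (4 * c ^ 2 + 3) <= n)%N by near: n; exact: nbhs_infty_ge.
have n_gt0 : 0 < n%:R :> R by rewrite ltr0n; near: n; exact: nbhs_infty_gt.
have [G [deg pp far]] := @exists_long_network c n (ltnW hc) n_big R.
apply: (@le_trans _ _ (diameter G)%:R); last first.
  rewrite ler_nat /max_diameter; apply: (leq_bigmax_cond (F := @diameter _) G).
  exact/asboolP.
rewrite mulrA -mulrBl ler_pdivrMr // -mulrBr -ln_div ?posrE //.
have nC_gt0 : 0 < n%:R / C%:R :> R by rewrite divr_gt0.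
have r_gt0 : 0 < c.+1%:R / c%:R :> R by rewrite divr_gt0 ?ltr0n; lia.
have : ln ((n%:R / C%:R) ^+ 2) <= ln ((c.+1%:R / c%:R) ^+ diameter G) :> R.
  by rewrite ler_ln ?posrE ?exprn_gt0.
rewrite !lnXn // -[ln _ *+ 2]mulr_natl => /le_trans; apply.
rewrite -[leLHS]mulr_natl; apply: ler_wpM2l; first exact: ler0n.
have le_mu : c.+1%:R / c%:R <= mu by exact: ratio_le.
by rewrite ler_ln ?posrE // (lt_le_trans r_gt0).
Unshelve. all: by end_near. Qed.

Theorem theorem2 (R : realType) (c : nat) (hc : (5 <= c)%N) :
  exists eps1 eps2 : nat -> R,
    [/\ eps1 n @[n --> \oo] --> (0 : R),
        eps2 n @[n --> \oo] --> (0 : R) &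
        \forall n \near \oo,
          (2 + eps1 n) * (ln n%:R / ln (c%:R / (c%:R - 2)))
            <= (max_diameter n (fun V => @degenerate V c))%:R
            <= (12 + eps2 n) * (ln n%:R / ln (c%:R / (c%:R - 2)))].
Proof.
have [A lower] := @max_diameter_ge R c hc; set mu := c%:R / (c%:R - 2) in lower *.
have c5 : 5 <= c%:R :> R by rewrite (ler_nat _ 5).
have mu1 : 1 < mu by rewrite ltr_pdivlMr; lra.
have lnmu : ln mu != 0 by rewrite gt_eqF // ln_gt0.
exists (fun n => - A / ln n%:R), (fun n => 4 * ln mu / ln n%:R).
split; [exact: cvg_div_ln | exact: cvg_div_ln |].
near=> n; have n1 : (1 < n)%N by near: n; exact: nbhs_infty_gt.
have lnn : ln n%:R != 0 :> R by rewrite gt_eqF // ln_gt0 // ltr1n.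
apply/andP; split.
  rewrite [leLHS](_ : _ = 2 * (ln n%:R / ln mu) - A / ln mu); first by near: n.
  by field; rewrite lnmu lnn.
rewrite [leRHS](_ : _ = 12 * (ln n%:R / ln mu) + 4); first exact: max_diameter_le.
by field; rewrite lnmu lnn.
Unshelve. all: by end_near. Qed.
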